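(* Let $\mathcal{H}$ be a Loynes $\mathcal{Z}$-space (pseudo-Hilbert space) over an admissible space $\mathcal{Z}$, and let $P,Q\in\mathcal{B}^*(\mathcal{H})$ be gramian self-adjoint projections on $\mathcal{H}$ such that $$\|P-Q\|<1,$$ where $\|\cdot\|$ is the operator norm on $\mathcal{B}(\mathcal{H})$ defined below. Then there exists a partial gramian isometry $T\in\mathcal{PI}(\mathcal{H})$ such that $P=T^*T$ and $Q=TT^*$.
   Context: An admissible space $\mathcal{Z}$ (in the sense of Loynes) is a complete Hausdorff locally convex topological vector space equipped with an involution $z\mapsto z^*$ and a closed convex cone $\mathcal{Z}_+$ defining an order $\le$ ($z_1\le z_2$ iff $z_2-z_1\in\mathcal{Z}_+$), such that positive elements are self-adjoint, the topology has a base of neighborhoods $V$ of $0$ that are solid ($0\le z_1\le z_2$, $z_2\in V$ implies $z_1\in V$), and every monotonically decreasing sequence of positive elements converges. A Loynes $\mathcal{Z}$-space $\mathcal{H}$ is a complex vector space with a $\mathcal{Z}$-valued inner product (gramian) $[\cdot,\cdot]:\mathcal{H}\times\mathcal{H}\to\mathcal{Z}$ that is linear in the first variable, satisfies $[h,k]^*=[k,h]$, $[h,h]\ge 0$, and $[h,h]=0$ only for $h=0$, and such that $\mathcal{H}$ is complete in the topology whose neighborhoods of $0$ are $\{h:[h,h]\in V\}$ for $V$ neighborhoods of $0$ in $\mathcal{Z}$. A linear operator $T:\mathcal{H}\to\mathcal{H}$ is bounded if there is $M>0$ with $[Th,Th]\le M^2[h,h]$ for all $h\in\mathcal{H}$;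 the set of such operators is $\mathcal{B}(\mathcal{H})$, normed by $\|T\|=\inf\{M: [Th,Th]\le M^2[h,h]\ \forall h\}$. The adjoint $T^*$ of $T$ (if it exists) is the linear operator with $[Th,k]=[h,T^*k]$ for all $h,k$; $\mathcal{B}^*(\mathcal{H})$ denotes the adjointable elements of $\mathcal{B}(\mathcal{H})$ (a $C^*$-algebra). A gramian self-adjoint projection is $P\in\mathcal{B}^*(\mathcal{H})$ with $P=P^*=P^2$. A subspace $\mathcal{M}$ is accessible if it has a gramian orthogonal complement $\mathcal{M}^\perp=\{h:[h,m]=0\ \forall m\in\mathcal{M}\}$ with $\mathcal{H}=\mathcal{M}\oplus\mathcal{M}^\perp$. A linear operator $T:\mathcal{H}\to\mathcal{H}$ is a partial gramian isometry if its kernel $\mathcal{N}(T)$ and range $\mathcal{R}(T)$ are accessible subspaces and $T$ restricted to $\mathcal{N}(T)^\perp$ is a gramian-preserving (gramian unitary) map onto $\mathcal{R}(T)$, i.e. $[Th,Tk]=[h,k]$ for $h,k\in\mathcal{N}(T)^\perp$. The set of these is denoted $\mathcal{PI}(\mathcal{H})$; its elements lie in $\mathcal{B}^*(\mathcal{H})$. *)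

(* Defs.v *)
From HB Require Import structures.
From mathcomp Require Import all_boot all_order all_algebra.
From mathcomp Require Import all_classical all_reals.
From mathcomp Require Import topology tvs.
From mathcomp Require Import complex.

Set Implicit Arguments.
Unset Strict Implicit.
Unset Printing Implicit Defensive.

Import Order.TTheory GRing.Theory Num.Theory.
Local Open Scope classical_set_scope.
Local Open Scope ring_scope.

(** Scalars: the complex numbers [R[i]] over a real field [R : realType].
    [Z] is a (Hausdorff) locally convex topological vector space over
    [R[i]] ([tvsType] of MathComp-Analysis is locally convex by definition). *)

Section Admissible.
Context (R : realType) (Z : tvsType R[i]).
Variables (star : Z -> Z) (Zpos : set Z).

Definition zle (z1 z2 : Z) : Prop := Zpos (z2 - z1).

Definition solid (V : set Z) : Prop :=
  forall z1 z2, zle 0 z1 -> zle z1 z2 -> V z2 -> V z1.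

Definition admissible : Prop :=
  hausdorff_space Z /\
  (forall F : set_system Z, ProperFilter F -> cauchy F ->
      exists l : Z, F --> l) /\
  (forall z, star (star z) = z) /\
  (forall z1 z2, star (z1 + z2) = star z1 + star z2) /\
  (forall (a : R[i]) z, star (a *: z) = conjc a *: star z) /\
  closed Zpos /\
  Zpos 0 /\
  (forall z1 z2, Zpos z1 -> Zpos z2 -> Zpos (z1 + z2)) /\
  (forall (t : R) z, 0 <= t -> Zpos z -> Zpos (real_complex R t *: z)) /\
  (forall z, Zpos z -> star z = z) /\
  (exists B : set_system Z,
      (forall V, B V -> nbhs (0 : Z) V) /\
      (forall U, nbhs (0 : Z) U -> exists2 V, B V & V `<=` U) /\
      (forall V, B V -> solid V)) /\
  (forall u : nat -> Z, (forall n, Zpos (u n)) ->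
      (forall n, zle (u n.+1) (u n)) ->
      exists l : Z, u @ \oo --> l).

End Admissible.

Section Loynes.
Context (R : realType) (Z : tvsType R[i]).
Variables (star : Z -> Z) (Zpos : set Z).
Context (H : lmodType R[i]) (g : H -> H -> Z).

(** Cauchy filters and convergence for the topology on H whose neighborhoods
    of 0 are {h | [h,h] \in V}, V a neighborhood of 0 in Z. *)
Definition gcauchy (F : set_system H) : Prop :=
  forall V : set Z, nbhs (0 : Z) V ->
    exists A, F A /\ forall x y, A x -> A y -> V (g (x - y) (x - y)).

Definition gconverges (F : set_system H) (h : H) : Prop :=
  forall V : set Z, nbhs (0 : Z) V -> F [set x | V (g (x - h) (x - h))].

Definition loynes_space : Prop :=
  [/\ forall (a : R[i]) h k l, g (a *: h + k) l = a *: g h l + g k l,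
      forall h k, star (g h k) = g k h,
      forall h, Zpos (g h h),
      forall h, g h h = 0 -> h = 0 &
      forall F : set_system H, ProperFilter F -> gcauchy F ->
        exists h, gconverges F h].

Definition linear_op (T : H -> H) : Prop :=
  forall (a : R[i]) h k, T (a *: h + k) = a *: T h + T k.

Definition op_bounds (T : H -> H) : set R :=
  [set M : R | 0 < M /\
     forall h, zle Zpos (g (T h) (T h)) (real_complex R (M ^+ 2) *: g h h)].

Definition bounded_op (T : H -> H) : Prop :=
  linear_op T /\ exists M, op_bounds T M.

Definition opnorm (T : H -> H) : R := inf (op_bounds T).

Definition is_adjoint (T S : H -> H) : Prop :=
  forall h k, g (T h) k = g h (S k).

Definition Bstar (T : H -> H) : Prop :=
  bounded_op T /\ exists S, is_adjoint T S.

Definition gram_projection (P : H -> H) : Prop :=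
  [/\ Bstar P, is_adjoint P P & forall h, P (P h) = P h].

Definition gperp (M : set H) : set H := [set h | forall m, M m -> g h m = 0].

Definition accessible (M : set H) : Prop :=
  forall h, exists m m', [/\ M m, gperp M m' & h = m + m'].

Definition kernel (T : H -> H) : set H := [set h | T h = 0].

Definition partial_isometry (T : H -> H) : Prop :=
  [/\ linear_op T,
      accessible (kernel T),
      accessible (range T),
      (forall h k, gperp (kernel T) h -> gperp (kernel T) k ->
          g (T h) (T k) = g h k) &
      (forall y, range T y -> exists2 h, gperp (kernel T) h & T h = y)].

End Loynes.

(* Main.v *)
Require Import Defs.
From HB Require Import structures.
From mathcomp Require Import all_boot all_order all_algebra.
From mathcomp Require Import all_classical all_reals.
From mathcomp Require Import topology tvs normedtype sequences.
From mathcomp Require Import complex ring lra.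

(* Let [D = P - Q] and [A = D^2], so that [A] is self-adjoint of norm [< 1],
   commutes with [P] and [Q], and satisfies [PQP = P(1 - A)], [QPQ = Q(1 - A)].
   Hence [T = Q P (1 - A)^(-1/2)] works. The inverse square root is
   [(1 - B)(1 - A)^(-1)], where [1 - B] is the square root of [1 - A], with [B]
   the limit of the contracting iteration [B_{n+1} = (A + B_n^2) / 2], and
   [(1 - A)^(-1)] is obtained from a Neumann iteration. *)

Set Implicit Arguments.
Unset Strict Implicit.
Unset Printing Implicit Defensive.

Import Order.TTheory GRing.Theory Num.Theory.
Local Open Scope classical_set_scope.
Local Open Scope ring_scope.
Local Open Scope complex_scope.

(** * Real scalars acting on a complex vector space *)

Section RealScalars.
Context (R : realType) (V : lmodType R[i]).
Implicit Types (s t : R) (v : V).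

Lemma scalerc1 v : 1%:C *: v = v.
Proof. by rewrite rmorph1 scale1r. Qed.

Lemma scalercD s t v : (s + t)%:C *: v = s%:C *: v + t%:C *: v.
Proof. by rewrite rmorphD scalerDl. Qed.

Lemma scalercM s t v : (s * t)%:C *: v = s%:C *: (t%:C *: v).
Proof. by rewrite rmorphM scalerA. Qed.

End RealScalars.

(** * Order and topology of an admissible space *)

Section Admissible.
Context (R : realType) (Z : tvsType R[i]) (star : Z -> Z) (Zpos : set Z).
Hypothesis HZ : admissible star Zpos.
Implicit Types (a b c d u v w z : Z) (s t : R).

Lemma Zpos_closed : closed Zpos.
Proof. by case: HZ => _ [_ [_ [_ [_ [? _]]]]]. Qed.

Lemma Zpos0 : Zpos 0.
Proof. by case: HZ => _ [_ [_ [_ [_ [_ [? _]]]]]]. Qed.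

Lemma ZposD u v : Zpos u -> Zpos v -> Zpos (u + v).
Proof. by case: HZ => _ [_ [_ [_ [_ [_ [_ [+ _]]]]]]]; apply. Qed.

Lemma ZposZ t u : 0 <= t -> Zpos u -> Zpos (t%:C *: u).
Proof. by case: HZ => _ [_ [_ [_ [_ [_ [_ [_ [+ _]]]]]]]]; apply. Qed.

Lemma starD u v : star (u + v) = star u + star v.
Proof. by case: HZ => _ [_ [_ [+ _]]]; apply. Qed.

Lemma starZ (x : R[i]) u : star (x *: u) = conjc x *: star u.
Proof. by case: HZ => _ [_ [_ [_ [+ _]]]]; apply. Qed.

Lemma nbhs0_solid (U : set Z) : nbhs (0 : Z) U ->
  exists W, [/\ nbhs (0 : Z) W, W `<=` U & solid Zpos W].
Proof.
case: HZ => _ [_ [_ [_ [_ [_ [_ [_ [_ [_ [[B [B1 [B2 B3]] _]]]]]]]]]]].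
by move=> /B2[V BV VU]; exists V; split; [exact: B1| |exact: B3].
Qed.

Lemma hausdorff_nbhs0 w : (forall U, nbhs (0 : Z) U -> U w) -> w = 0.
Proof.
case: HZ => hT _ h0; apply/esym/hT => U V U0 Vw.
exists w; split; first exact: h0.
exact: nbhs_singleton.
Qed.

Lemma zle_refl u : zle Zpos u u.
Proof. by rewrite /zle subrr; exact: Zpos0. Qed.

Lemma zle_trans v u w : zle Zpos u v -> zle Zpos v w -> zle Zpos u w.
Proof. by rewrite /zle => uv vw; rewrite -(subrKA v); exact: ZposD. Qed.

Lemma zle_add a b c d :
  zle Zpos a b -> zle Zpos c d -> zle Zpos (a + c) (b + d).
Proof. by rewrite /zle => ab cd; rewrite opprD addrACA; exact: ZposD. Qed.

Lemma zle_scale t a b : 0 <= t -> zle Zpos a b ->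
  zle Zpos (t%:C *: a) (t%:C *: b).
Proof. by rewrite /zle -scalerBr; exact: ZposZ. Qed.

Lemma zle_scaleW s t z : Zpos z -> s <= t -> zle Zpos (s%:C *: z) (t%:C *: z).
Proof.
move=> z0 st; rewrite /zle -scalerBl -rmorphB.
by apply: ZposZ; rewrite ?subr_ge0.
Qed.

(** Pointedness of the cone comes from the topology: [0 <= u - v <= 0] puts [u - v] in every solid
    neighborhood of 0, and the space is Hausdorff. *)
Lemma zle_anti u v : zle Zpos u v -> zle Zpos v u -> u = v.
Proof.
move=> uv vu; apply/eqP; rewrite -subr_eq0; apply/eqP/hausdorff_nbhs0 => U.
move=> /nbhs0_solid[W [W0 WU solW]]; apply/WU/(solW _ 0).
- by rewrite /zle subr0.
- by rewrite /zle sub0r opprB.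
- exact: nbhs_singleton.
Qed.

Lemma Zpos_lim w :
  (forall U, nbhs (0 : Z) U -> exists2 v, U v & Zpos (w + v)) -> Zpos w.
Proof.
move=> h; apply: Zpos_closed => U Uw.
have /h[_ [u Uu <-]] : nbhs (0 : Z) (+%R (- w) @` U).
  by rewrite -(addNr w); exact: nbhsB.
by rewrite addrA subrr add0r => u0; exists u.
Qed.

Lemma nbhs0_small (U : set Z) z : nbhs (0 : Z) U ->
  exists2 d : R, 0 < d & forall t, 0 <= t < d -> U (t%:C *: z).
Proof.
move=> U0.
have := @scale_continuous R[i] Z (0, z) U; rewrite /= scale0r => /(_ U0).
case=> -[V1 V2] /= [V10 V2z] V12.
have /nbhs_ballP[e /= e0 eV1] := V10.
(* The radius [e] lives in [R[i]]; being positive, it has zero imaginary part. *)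
exists (complex.Re e); first by move: e0; rewrite ltcE => /andP[].
move=> t /andP[t0 te]; apply: (V12 (t%:C, z)); split => /=; last first.
  exact: nbhs_singleton.
apply: eV1; rewrite /ball /= sub0r normrN ger0_norm ?ler0c //.
by move: e0; rewrite !ltcE /= te => /andP[/eqP <-]; rewrite eqxx.
Qed.

Lemma nbhs0_small_sqr (U : set Z) z : nbhs (0 : Z) U ->
  exists2 e : R, 0 < e & U ((e ^+ 2)%:C *: z).
Proof.
(* This value is positive and its square stays below [d]. *)
move=> /(nbhs0_small z)[d d0 dU]; exists (d / (1 + d)).
  by rewrite divr_gt0 // addr_gt0.
apply: dU; rewrite sqr_ge0 /= expr_div_n ltr_pdivrMr ?exprn_gt0 ?addr_gt0 //.
nra.
Qed.

(** Archimedean property: [e z] tends to 0 with [e], and the cone is closed. *)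
Lemma Zpos_lim_eps w z :
  (forall e : R, 0 < e -> zle Zpos w (e%:C *: z)) -> zle Zpos w 0.
Proof.
move=> h; rewrite /zle sub0r.
apply: Zpos_lim => U /(nbhs0_small_sqr z)[e e0 Ue].
exists ((e ^+ 2)%:C *: z) => //; rewrite addrC; apply: h; exact: exprn_gt0.
Qed.

End Admissible.

(** * The gramian: sesquilinearity and a substitute for the triangle inequality *)

Section Gramian.
Context (R : realType) (Z : tvsType R[i]) (star : Z -> Z) (Zpos : set Z).
Hypothesis HZ : admissible star Zpos.
Context (H : lmodType R[i]) (g : H -> H -> Z).
Hypothesis HH : loynes_space star Zpos g.
Implicit Types (h k l x y : H) (w z : Z) (s t a b e : R).

Lemma gramDl h k l : g (h + k) l = g h l + g k l.
Proof. by case: HH => lin _ _ _ _; rewrite -{1}(scale1r h) lin scale1r. Qed.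

Lemma gram0l l : g 0 l = 0.
Proof. by apply: (addrI (g 0 l)); rewrite -gramDl !addr0. Qed.

Lemma gramZl (c : R[i]) h l : g (c *: h) l = c *: g h l.
Proof.
by case: HH => lin _ _ _ _; rewrite -{1}(addr0 (c *: h)) lin gram0l addr0.
Qed.

Lemma gram_star h k : star (g h k) = g k h.
Proof. by case: HH. Qed.

Lemma gram_ge0 h : Zpos (g h h).
Proof. by case: HH. Qed.

Lemma gram_eq0 h : g h h = 0 -> h = 0.
Proof. by case: HH => _ _ _ + _; apply. Qed.

Lemma gramNl h l : g (- h) l = - g h l.
Proof. by rewrite -scaleN1r gramZl scaleN1r. Qed.

Lemma gramBl h k l : g (h - k) l = g h l - g k l.
Proof. by rewrite gramDl gramNl. Qed.

Lemma gramDr l h k : g l (h + k) = g l h + g l k.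
Proof. by rewrite -!(gram_star _ l) gramDl (starD HZ). Qed.

Lemma gramZr (c : R[i]) l h : g l (c *: h) = conjc c *: g l h.
Proof. by rewrite -!(gram_star _ l) gramZl (starZ HZ). Qed.

Lemma gramNr l h : g l (- h) = - g l h.
Proof. by rewrite -scaleN1r gramZr rmorphN rmorph1 scaleN1r. Qed.

Lemma gramBr l h k : g l (h - k) = g l h - g l k.
Proof. by rewrite gramDr gramNr. Qed.

Lemma gram0r l : g l 0 = 0.
Proof. by rewrite -(subrr 0) gramBr subrr. Qed.

Lemma gram_nondeg x y : (forall k, g x k = g y k) -> x = y.
Proof.
move=> xy; apply/eqP; rewrite -subr_eq0; apply/eqP/gram_eq0.
by rewrite gramBl xy subrr.
Qed.

Lemma gramDD x y : g (x + y) (x + y) = g x x + g y y + (g x y + g y x).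
Proof. by rewrite gramDl !gramDr [g y x + _]addrC addrACA. Qed.

Lemma gramZZ t x : g (t%:C *: x) (t%:C *: x) = (t ^+ 2)%:C *: g x x.
Proof. by rewrite gramZl gramZr conjc_real expr2 scalercM. Qed.

Lemma gramNN x : g (- x) (- x) = g x x.
Proof. by rewrite gramNl gramNr opprK. Qed.

(** Positivity of [[t x - y, t x - y]], divided by [t], bounds the cross terms by [t [x, x] + t^-1
    [y, y]]. This stands in for Cauchy-Schwarz. *)
Lemma gramD_le t x y : 0 < t ->
  zle Zpos (g (x + y) (x + y)) ((1 + t)%:C *: g x x + (1 + t^-1)%:C *: g y y).
Proof.
move=> t0; have := gram_ge0 (t%:C *: x - y).
have t1 : 0 <= t^-1 by rewrite invr_ge0 ltW.
move=> /(ZposZ HZ t1); rewrite /zle.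
congr (Zpos _); rewrite !gramDD gramNN gramZZ gramNr gramNl gramZl gramZr.
rewrite conjc_real -opprD -scalerDr !scalercD !scalerc1.
rewrite scalerBr -scalercM mulVf ?gt_eqF // scalerc1 scalerDr -scalercM.
rewrite expr2 mulKf ?gt_eqF // [in RHS]opprD [RHS]addrA; congr (_ - _).
by rewrite addrACA [RHS]addrC addKr.
Qed.

(** * Domination and convergence relative to a positive element *)

(** Squared form of [|x| <= a * sqrt z], so that no square root is taken in [Z]. *)
Definition dominated z a x : Prop := zle Zpos (g x x) ((a ^+ 2)%:C *: z).

(** Triangle inequality: taking [t = b / a] in [gramD_le] yields exactly the constant
    [(a + b) ^+ 2]. *)
Lemma dominatedD z a b x y : 0 < a -> 0 < b ->
  dominated z a x -> dominated z b y -> dominated z (a + b) (x + y).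
Proof.
move=> a0 b0 xa yb; have ab0 : 0 < b / a by rewrite divr_gt0.
apply: (zle_trans HZ (gramD_le x y ab0)).
have -> : (a + b) ^+ 2 = (1 + b / a) * a ^+ 2 + (1 + (b / a)^-1) * b ^+ 2.
  by field; rewrite !gt_eqF.
rewrite [X in zle _ _ X]scalercD (scalercM (1 + b / a)) (scalercM (1 + _^-1)).
apply: (zle_add HZ); apply: (zle_scale HZ) => //.
  by rewrite addr_ge0 // ltW.
by rewrite addr_ge0 // invr_ge0 ltW.
Qed.

Lemma dominatedN z a x : dominated z a x -> dominated z a (- x).
Proof. by rewrite /dominated gramNN. Qed.

Lemma dominatedBC z a x y : dominated z a (x - y) -> dominated z a (y - x).
Proof. by move=> /dominatedN; rewrite opprB. Qed.

Lemma dominatedZ z a t x : dominated z a x -> dominated z (t * a) (t%:C *: x).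
Proof.
move=> xa; rewrite /dominated gramZZ exprMn (scalercM (t ^+ 2)).
by apply: (zle_scale HZ) => //; exact: sqr_ge0.
Qed.

Lemma dominatedW z a b x : Zpos z -> 0 <= a -> a <= b ->
  dominated z a x -> dominated z b x.
Proof.
move=> z0 a0 ab xa; apply: (zle_trans HZ xa); apply: (zle_scaleW HZ) => //.
by rewrite ler_sqr ?nnegrE // (le_trans a0).
Qed.

Lemma dominated_zle z z' a x : zle Zpos z z' -> dominated z a x ->
  dominated z' a x.
Proof.
move=> zz' xa; apply: (zle_trans HZ xa).
by apply: (zle_scale HZ _ zz'); exact: sqr_ge0.
Qed.

Lemma dominated0 z a : Zpos z -> dominated z a 0.
Proof.
move=> z0; rewrite /dominated gram0l /zle subr0.
by apply: (ZposZ HZ) => //; exact: sqr_ge0.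
Qed.

Lemma dominated_eq0 z x : (forall e, 0 < e -> dominated z e x) -> x = 0.
Proof.
move=> xe; apply/gram_eq0/(zle_anti HZ); last first.
  by rewrite /zle subr0; exact: gram_ge0.
apply: (Zpos_lim_eps HZ (z := z)) => e e0.
have := xe (Num.sqrt e); rewrite sqrtr_gt0 => /(_ e0).
by rewrite /dominated sqr_sqrtr // ltW.
Qed.

(* Convergence relative to a positive element of [Z]: all limits needed are of
    this kind, and unlike convergence in the topology of [H] it passes through
    the order estimates directly. *)
Definition rel_cvg (x : nat -> H) l : Prop :=
  exists2 z, Zpos z & forall e, 0 < e ->
    exists N, forall n, (N <= n)%N -> dominated z e (x n - l).

Lemma rel_cvg_uniq (x : nat -> H) l l' : rel_cvg x l -> rel_cvg x l' -> l = l'.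
Proof.
move=> [z z0 xl] [z' z'0 xl']; apply/eqP; rewrite -subr_eq0; apply/eqP.
(* The two limits may refer to different elements of [Z]; their sum dominates both. *)
apply: (@dominated_eq0 (z + z')) => e e0.
have e20 : 0 < e / 2 by rewrite divr_gt0.
have [N xlN] := xl _ e20; have [N' xlN'] := xl' _ e20.
rewrite [e]splitr -(subrKA (x (maxn N N'))); apply: dominatedD => //.
- apply: dominatedBC; apply: (dominated_zle _ (xlN _ (leq_maxl _ _))).
  by rewrite /zle addrC addKr.
- apply: (dominated_zle _ (xlN' _ (leq_maxr _ _))).
  by rewrite /zle addrK.
Qed.

Lemma rel_cvgD (x y : nat -> H) l m : rel_cvg x l -> rel_cvg y m ->
  rel_cvg (fun n => x n + y n) (l + m).
Proof.
move=> [z z0 xl] [z' z'0 ym]; exists (z + z'); first exact: (ZposD HZ).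
move=> e e0; have e20 : 0 < e / 2 by rewrite divr_gt0.
have [N xlN] := xl _ e20; have [N' ymN'] := ym _ e20.
exists (maxn N N') => n; rewrite geq_max => /andP[Nn N'n].
rewrite [e]splitr opprD addrACA; apply: dominatedD => //.
- by apply: (dominated_zle _ (xlN _ Nn)); rewrite /zle addrC addKr.
- by apply: (dominated_zle _ (ymN' _ N'n)); rewrite /zle addrK.
Qed.

Lemma rel_cvg_cst l : rel_cvg (fun=> l) l.
Proof.
exists 0; first exact: (Zpos0 HZ).
move=> e e0; exists 0%N => n _; rewrite subrr.
by apply: dominated0; exact: (Zpos0 HZ).
Qed.

(** * Bounded operators and completeness for relative convergence *)

Definition op_le (T : H -> H) a := forall h, dominated (g h h) a (T h).

Lemma dominated_op T z a b x : op_le T a -> dominated z b x ->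
  dominated z (a * b) (T x).
Proof.
move=> Ta xb; apply: (zle_trans HZ (Ta x)); rewrite exprMn (scalercM (a ^+ 2)).
by apply: (zle_scale HZ) => //; exact: sqr_ge0.
Qed.

(** Stated as a difference because [T n l] is not assumed to converge; the uniform bound [a] lets
    the operator vary with [n]. *)
Lemma rel_cvg_op (T : nat -> H -> H) a (x : nat -> H) l : 0 < a ->
  (forall n, {morph T n : u v / u - v}) -> (forall n, op_le (T n) a) ->
  rel_cvg x l -> rel_cvg (fun n => T n (x n) - T n l) 0.
Proof.
move=> a0 Tlin Ta [z z0 xl]; exists z => // e e0.
have [N xlN] := xl _ (divr_gt0 e0 a0); exists N => n Nn.
have -> : e = a * (e / a) by rewrite mulrC divfK ?gt_eqF.
by rewrite subr0 -Tlin; apply: dominated_op; [exact: Ta|exact: xlN].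
Qed.

Lemma rel_cvg_op1 T a (x : nat -> H) l : 0 < a ->
  {morph T : u v / u - v} -> op_le T a ->
  rel_cvg x l -> rel_cvg (fun n => T (x n)) (T l).
Proof.
move=> a0 Tlin Ta xl.
have Tx := rel_cvg_op (T := fun=> T) a0 (fun=> Tlin) (fun=> Ta) xl.
have := rel_cvgD Tx (rel_cvg_cst (T l)).
rewrite add0r; congr rel_cvg; apply/funext => n.
by rewrite subrK.
Qed.

(** With [n = |c|^2], [n <= (1 + n)^2] gives a bound that is positive even for [c = 0]. *)
Lemma op_leZ (c : R[i]) : exists2 a, 0 < a & op_le ( *:%R c) a.
Proof.
pose n := complex.Re c ^+ 2 + complex.Im c ^+ 2.
have n0 : 0 <= n by rewrite addr_ge0 // sqr_ge0.
exists (1 + n); first by rewrite ltr_wpDr.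
move=> h; rewrite /dominated gramZl gramZr scalerA.
have -> : c * conjc c = n%:C.
  rewrite /n; case: c {n n0} => u v /=; apply/eqP; rewrite eq_complex /=.
  by apply/andP; split; apply/eqP; ring.
apply: (zle_scaleW HZ); first exact: gram_ge0.
nra.
Qed.

Lemma rel_cvgZ (c : R[i]) (x : nat -> H) l : rel_cvg x l ->
  rel_cvg (fun n => c *: x n) (c *: l).
Proof.
have [a a0 ca] := op_leZ c; apply: (rel_cvg_op1 a0 _ ca) => u v.
exact: scalerBr.
Qed.

(** Solid neighborhoods turn the order estimates into a Cauchy filter, completeness gives [l], and
    closedness of the cone carries the estimate over to [x n - l]. *)
Lemma rel_cauchy_cvg (x : nat -> H) z : Zpos z ->
  (forall e, 0 < e ->
     exists N, forall n, (N <= n)%N -> dominated z e (x n - x N)) ->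
  exists l, rel_cvg x l.
Proof.
move=> z0 xC.
have xC2 e : 0 < e -> exists N, forall m n, (N <= m)%N -> (N <= n)%N ->
    dominated z e (x n - x m).
  move=> e0; have e20 : 0 < e / 2 by rewrite divr_gt0.
  have [N xN] := xC _ e20; exists N => m n Nm Nn.
  rewrite [e]splitr -(subrKA (x N)); apply: dominatedD => //; first exact: xN.
  by apply: dominatedBC; exact: xN.
have : gcauchy g (x @ \oo).
  move=> V /(nbhs0_solid HZ)[W [W0 WV solW]].
  have [e e0 We] := nbhs0_small_sqr z W0; have [N xN] := xC2 _ e0.
  exists [set x n | n in [set n | (N <= n)%N]]; split.
    by exists N => // n Nn; exists n.
  move=> _ _ [n Nn <-] [m Nm <-]; apply/WV/(solW _ _ _ (xN m n Nm Nn) We).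
  by rewrite /zle subr0; exact: gram_ge0.
case: HH => _ _ _ _ /[apply] -[l xl]; exists l, z => // e e0.
have e20 : 0 < e / 2 by rewrite divr_gt0.
have [N xN] := xC2 _ e20; exists N => n Nn.
(* The constant that [gramD_le] with [t = 1] makes of the bound [e / 2]; it is at most [e ^+ 2]. *)
pose w := (e / 2) ^+ 2 *+ 2.
suff : zle Zpos (g (x n - l) (x n - l)) (w%:C *: z).
  move=> /(zle_trans HZ); apply; apply: (zle_scaleW HZ) => //.
  by rewrite /w; nra.
apply: (Zpos_lim HZ) => U U0.
(* [U] is halved, so that [u = 2 [x_m - l, x_m - l]] lies in [U] for large [m]. *)
have h0 : (1 + 1^-1)^-1%:C != 0 :> R[i].
  by rewrite fmorph_eq0 invr_eq0 gt_eqF // addr_gt0 // invr_gt0.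
have [M _ xM] := xl _ (nbhs0Z h0 U0).
have [u Uu uE] := xM (maxn M N) (leq_maxl _ _).
exists u => //.
have -> : u = (1 + 1^-1)%:C *: g (x (maxn M N) - l) (x (maxn M N) - l).
  rewrite -uE -scalercM divff ?scalerc1 //.
  by rewrite gt_eqF // addr_gt0 // invr_gt0.
have k0 : 0 <= 1 + 1 :> R by rewrite addr_ge0.
have := gramD_le (x n - x (maxn M N)) (x (maxn M N) - l) ltr01.
rewrite subrKA => /(zle_trans HZ); set v := _ *: g (x (maxn M N) - l) _.
move=> /(_ _ (zle_add HZ (zle_scale HZ k0 (xN _ n (leq_maxr _ _) Nn))
  (zle_refl HZ v))).
rewrite -scalercM [_ * _](_ : _ = w) /w; last by ring.
by rewrite /zle addrAC; apply.
Qed.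

(** Telescoping: everything after index [n] stays within the geometric tail [s ^+ n / (1 - s)] of
    [x n]. *)
Lemma rel_cvg_geometric (x : nat -> H) z s : Zpos z -> 0 < s < 1 ->
  (forall n, dominated z (s ^+ n) (x n.+1 - x n)) -> exists l, rel_cvg x l.
Proof.
move=> z0 /andP[s0 s1] xs; apply: (rel_cauchy_cvg z0) => e e0.
have s10 : 0 < 1 - s by rewrite subr_gt0.
have xk j n : dominated z (s ^+ n / (1 - s)) (x (n + j)%N - x n).
  elim: j n => [|j IH] n; first by rewrite addn0 subrr; exact: dominated0.
  rewrite -addSnnS -(subrKA (x n.+1)).
  have -> : s ^+ n / (1 - s) = s ^+ n.+1 / (1 - s) + s ^+ n.
    by rewrite exprS; field; rewrite gt_eqF.
  by apply: dominatedD; rewrite ?divr_gt0 ?exprn_gt0.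
have e1 : 0 < e * (1 - s) by rewrite mulr_gt0.
have ns : `|s| < 1 by rewrite gtr0_norm.
have [N _ sN] := @cvgr0_norm_lt _ R^o _ _ _ _ (cvg_expr ns) _ e1.
exists N => n /subnKC <-; apply: (dominatedW z0 _ _ (xk _ _)).
  by rewrite divr_ge0 ?exprn_ge0 ?ltW.
rewrite ler_pdivrMr // -(ger0_norm (exprn_ge0 N (ltW s0))).
by apply/ltW/sN => /=.
Qed.

Lemma rel_cvgS (x : nat -> H) l : rel_cvg x l -> rel_cvg (fun n => x n.+1) l.
Proof.
move=> [z z0 xl]; exists z => // e /xl[N xN]; exists N => n Nn.
by apply/xN/leqW.
Qed.

(** * Linear operators and the Neumann iteration *)

Lemma linear_opD (T : H -> H) : linear_op T -> {morph T : h k / h + k}.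
Proof. by move=> T1 h k; rewrite -{1}(scale1r h) T1 scale1r. Qed.

Lemma linear_op0 (T : H -> H) : linear_op T -> T 0 = 0.
Proof. by move=> /linear_opD T1; apply: (addrI (T 0)); rewrite -T1 !addr0. Qed.

Lemma linear_opZ (T : H -> H) : linear_op T ->
  forall (c : R[i]) h, T (c *: h) = c *: T h.
Proof. by move=> T1 c h; rewrite -{1}(addr0 (c *: h)) T1 linear_op0 ?addr0. Qed.

Lemma linear_opB (T : H -> H) : linear_op T -> {morph T : h k / h - k}.
Proof.
by move=> T1 h k; rewrite linear_opD // -scaleN1r linear_opZ // scaleN1r.
Qed.

(** Nondegeneracy of the gramian forces linearity; this serves for operators that are only chosen
    pointwise. *)
Lemma is_adjoint_linear (T S : H -> H) : is_adjoint g T S -> linear_op T.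
Proof.
move=> TS c h k; apply: gram_nondeg => l.
by rewrite TS !(gramDl, gramZl) !TS.
Qed.

(** [[y, y] <= s^2 [y, y]] gives [(1 - s^2) [y, y] <= 0]. For linear [K] this is injectivity of
    [1 - K]. *)
Lemma op_le_fixpoint (K : H -> H) s y : 0 < s < 1 -> op_le K s ->
  K y = y -> y = 0.
Proof.
move=> /andP[s0 s1] /(_ y) + yK; rewrite /dominated yK => ys.
apply/gram_eq0/(zle_anti HZ); last by rewrite /zle subr0; exact: gram_ge0.
have s21 : 0 < 1 - s ^+ 2 by rewrite subr_gt0 expr_lt1 // ltW.
have s2V : 0 <= (1 - s ^+ 2)^-1 by rewrite invr_ge0 ltW.
have /(ZposZ HZ s2V) := ys.
rewrite -{2}(scalerc1 (g y y)) -scalerBl -rmorphB -scalercM /zle sub0r.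
rewrite (_ : _ * _ = - 1) ?rmorphN ?rmorph1 ?scaleN1r //.
by field; rewrite gt_eqF.
Qed.

(** The increments of [x_{n+1} = h + K x_n], [x_0 = 0], are [K^n h], hence geometrically small. *)
Lemma neumann (K : H -> H) s h : 0 < s < 1 -> linear_op K -> op_le K s ->
  exists x, x - K x = h.
Proof.
move=> s01 K1 Ks; have /andP[s0 _] := s01.
pose x n := iter n (fun x => h + K x) 0.
have xs n : dominated (g h h) (s ^+ n) (x n.+1 - x n).
  elim: n => [|n IH].
    rewrite /x /= linear_op0 // addr0 subr0 /dominated expr1n scalerc1.
    exact: (zle_refl HZ).
  rewrite {1}/x iterS -/(x n.+1) {2}/x iterS -/(x n) opprD addrACA subrr add0r.
  by rewrite -linear_opB // exprS; exact: dominated_op.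
have [l xl] := rel_cvg_geometric (gram_ge0 h) s01 xs; exists l.
apply/eqP; rewrite subr_eq; apply/eqP.
apply: (rel_cvg_uniq (rel_cvgS xl)); rewrite /x /=.
apply: rel_cvgD; first exact: rel_cvg_cst.
by apply: (rel_cvg_op1 s0 _ Ks xl); exact: linear_opB.
Qed.

(* Expand [g (d - e c^* h) (d - e c^* h) >= 0]. *)
Lemma gram_cross_le (c : R[i]) z e d h : c * conjc c = 1 -> 0 < e ->
  dominated z e d -> zle Zpos (g h h) z ->
  zle Zpos (c *: g d h + conjc c *: g h d) ((e *+ 2)%:C *: z).
Proof.
move=> c1 e0 de hz.
have ei : 0 <= e^-1 by rewrite invr_ge0 ltW.
have e2 : 0 <= e ^+ 2 by rewrite sqr_ge0.
have hE : zle Zpos (e%:C *: (c *: g d h + conjc c *: g h d))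
    (g d d + (e ^+ 2)%:C *: g h h).
  have eC : conjc (e%:C * conjc c) = e%:C * c.
    case: c {c1} => u v; apply/eqP; rewrite eq_complex /=.
    by apply/andP; split; apply/eqP; ring.
  have := gram_ge0 (d - (e%:C * conjc c) *: h); rewrite /zle.
  congr Zpos; rewrite gramDD gramNN gramNl gramNr !gramZl !gramZr.
  rewrite eC scalerA -opprD; congr (_ + _ - _).
    congr (_ *: _); rewrite mulrACA [conjc c * c]mulrC c1 mulr1.
    by rewrite -rmorphM -expr2.
  by rewrite scalerDr !scalerA.
have := zle_trans HZ hE (zle_add HZ de (zle_scale HZ e2 hz)).
move=> /(zle_scale HZ ei); rewrite -scalercM mulVf ?gt_eqF // scalerc1.
rewrite -scalercD -scalercM; congr (zle _ _ (_%:C *: _)).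
by rewrite mulr2n; field; rewrite gt_eqF.
Qed.

(** * Self-adjointness of pointwise limits *)

(** The cross estimate gives [c ([T h, h] - [h, T h]) <= 0] for [c = 'i] and [c = - 'i], hence
    equality on the diagonal; polarization extends it to all pairs. *)
Lemma is_adjoint_lim (Tn : nat -> H -> H) T :
  (forall n, is_adjoint g (Tn n) (Tn n)) ->
  (forall h, rel_cvg (fun n => Tn n h) (T h)) -> is_adjoint g T T.
Proof.
move=> TnA TnT.
have TnL n : linear_op (Tn n) by exact: is_adjoint_linear (TnA n).
have TD : {morph T : h k / h + k}.
  move=> h k; apply: (rel_cvg_uniq (TnT _)).
  have := rel_cvgD (TnT h) (TnT k); congr rel_cvg; apply/funext => n.
  by rewrite linear_opD.
have TZ (c : R[i]) h : T (c *: h) = c *: T h.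
  apply: (rel_cvg_uniq (TnT _)).
  have := rel_cvgZ c (TnT h); congr rel_cvg; apply/funext => n.
  by rewrite linear_opZ.
(* The two conditions say that [c] is ['i] or [- 'i]. In the cross estimate for [d = T h - Tn N h],
   the terms in [Tn N] cancel by self-adjointness. *)
have cle (c : R[i]) h : c * conjc c = 1 -> conjc c = - c ->
    zle Zpos (c *: (g (T h) h - g h (T h))) 0.
  move=> c1 cN; have [z z0 Tz] := TnT h.
  apply: (Zpos_lim_eps HZ (z := z + g h h)) => e e0.
  have e20 : 0 < e / 2 by rewrite divr_gt0.
  have [N /(_ N (leqnn _)) TN] := Tz _ e20.
  have zz : zle Zpos z (z + g h h).
    by rewrite /zle addrC addKr; exact: gram_ge0.
  have hz : zle Zpos (g h h) (z + g h h) by rewrite /zle addrK.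
  have := gram_cross_le c1 e20 (dominated_zle zz (dominatedBC TN)) hz.
  rewrite mulr2n -splitr; congr (zle _ _ _).
  rewrite cN scaleNr -scalerBr; congr (_ *: _).
  by rewrite gramBl gramBr TnA opprB addrA subrK.
have iN : conjc 'i = - 'i :> R[i].
  by apply/eqP; rewrite eq_complex /= oppr0 !eqxx.
have i1 : 'i * conjc 'i = 1 :> R[i] by rewrite iN mulrN -expr2 sqr_i opprK.
have Tdiag h : g (T h) h = g h (T h).
  pose w := 'i *: (g (T h) h - g h (T h)).
  have w0 : w = 0.
    apply: (zle_anti HZ); first exact: cle.
    have iNN : conjc (- 'i) = - - 'i :> R[i].
      by apply/eqP; rewrite eq_complex /= !oppr0 opprK !eqxx.
    have iN1 : - 'i * conjc (- 'i) = 1 :> R[i].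
      by rewrite iNN opprK mulNr -expr2 sqr_i opprK.
    by have := cle _ h iN1 iNN; rewrite /zle scaleNr -/w sub0r opprK subr0.
  apply/eqP; rewrite -subr_eq0; apply/eqP.
  by rewrite -[LHS]scale1r -i1 mulrC -scalerA -/w w0 scaler0.
(* The form [[T h, k] - [h, T k]] vanishes on the diagonal, so expanding at [h + k] shows it
   antisymmetric. *)
have anti h k : g (T h) k - g h (T k) = - (g (T k) h - g k (T h)).
  have := Tdiag (h + k); rewrite TD !gramDl !gramDr !Tdiag -!addrA => /addrI.
  rewrite !addrA => /addIr hk.
  by apply/eqP; rewrite opprB subr_eq addrAC -subr_eq opprK hk addrC.
move=> h k; apply/eqP; rewrite -subr_eq0.
(* Replacing [h] by ['i *: h] makes the form symmetric as well, so twice it is 0. *)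
have := anti ('i *: h) k.
rewrite TZ !gramZl !gramZr iN !scaleNr opprB !opprK.
have i0 : 'i != 0 :> R[i].
  by rewrite eq_complex /= oner_eq0 andbF.
rewrite [RHS]addrC -!scalerBr => /(scalerI i0) hk.
have := anti h k; rewrite -hk => /eqP; rewrite -addr_eq0 -mulr2n -scaler_nat.
by rewrite scaler_eq0 pnatr_eq0.
Qed.

(** * Square root and inverse square root of [1 - A] *)

(** [(1 - B)^2 = 1 - A] is the fixed point equation [B = (A + B^2) / 2]. The iterates are
    polynomials in [A], so self-adjointness and commutation hold for them and pass to the limit. *)
Lemma sqrt_one_minus (A : H -> H) s : 0 < s < 1 ->
  is_adjoint g A A -> op_le A s ->
  exists B, [/\ is_adjoint g B B,
    forall h, h - B h - B (h - B h) = h - A h &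
    forall C a, 0 < a -> linear_op C -> op_le C a ->
      (forall h, C (A h) = A (C h)) -> forall h, C (B h) = B (C h)].
Proof.
move=> s01 AA As; have /andP[s0 s1] := s01.
have AL := is_adjoint_linear AA.
pose Bn n : H -> H :=
  iter n (fun (B : H -> H) h => 2^-1%:C *: (A h + B (B h))) (fun=> 0).
have BnS n h : Bn n.+1 h = 2^-1%:C *: (A h + Bn n (Bn n h)) by [].
have BnA n : is_adjoint g (Bn n) (Bn n).
  elim: n => [|n IH] h k; first by rewrite /Bn /= gram0l gram0r.
  by rewrite !BnS gramZl gramZr conjc_real gramDl gramDr AA !IH.
have BnL n := is_adjoint_linear (BnA n).
have BnC n C : linear_op C -> (forall h, C (A h) = A (C h)) ->
    forall h, C (Bn n h) = Bn n (C h).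
  move=> CL CA; elim: n => [|n IH] h; first by rewrite /Bn /= linear_op0.
  by rewrite !BnS linear_opZ // linear_opD // CA !IH.
have BnAC n h : Bn n (A h) = A (Bn n h) by rewrite -(BnC n A AL).
have BnBn m n h : Bn m (Bn n h) = Bn n (Bn m h) by exact: BnC.
(* The bound [s] is preserved since [(s + s^2) / 2 <= s]. *)
have Bns n : op_le (Bn n) s.
  elim: n => [|n IH] h; first exact/dominated0/gram_ge0.
  rewrite BnS; apply: (dominatedW (a := 2^-1 * (s + s * s))).
  - exact: gram_ge0.
  - by rewrite mulr_ge0 ?invr_ge0 // addr_ge0 ?mulr_ge0 // ltW.
  - nra.
  - apply: dominatedZ; apply: dominatedD => //; first exact: mulr_gt0.
    by apply: dominated_op => //; exact: IH.
(* As the iterates commute, [B_{n+2} - B_{n+1} = (B_{n+1} + B_n) (B_{n+1} - B_n) / 2], so each step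
   contracts by [s]. *)
have Bnd n h : dominated (g h h) (s ^+ n) (Bn n.+1 h - Bn n h).
  elim: n h => [|n IH] h.
    rewrite BnS /Bn /= subr0 addr0 expr0.
    apply: (dominatedW (a := 2^-1 * s)); first exact: gram_ge0.
    - by rewrite mulr_ge0 ?invr_ge0 // ltW.
    - lra.
    - exact: dominatedZ.
  have -> : Bn n.+2 h - Bn n.+1 h = 2^-1%:C *:
      (Bn n.+1 (Bn n.+1 h - Bn n h) + Bn n (Bn n.+1 h - Bn n h)).
    rewrite BnS [X in _ - X]BnS -scalerBr opprD addrACA subrr add0r.
    rewrite (linear_opB (BnL n.+1)) (linear_opB (BnL n)).
    by rewrite (BnBn n.+1 n h) subrKA.
  have -> : s ^+ n.+1 = 2^-1 * (s * s ^+ n + s * s ^+ n).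
    by rewrite exprS; field.
  have sn : 0 < s * s ^+ n by rewrite mulr_gt0 ?exprn_gt0.
  apply: dominatedZ; apply: dominatedD => //;
    by apply: dominated_op => //; exact: IH.
have /choice[B BnB] : forall h, exists l, rel_cvg (fun n => Bn n h) l.
  by move=> h; exact: (rel_cvg_geometric (gram_ge0 h) s01 (Bnd^~ h)).
have BA := is_adjoint_lim BnA BnB.
have BL := is_adjoint_linear BA.
have BB h : B h = 2^-1%:C *: (A h + B (B h)).
  apply: (rel_cvg_uniq (rel_cvgS (BnB h))).
  apply/rel_cvgZ/rel_cvgD; first exact: rel_cvg_cst.
  (* [B_n (B_n h)] splits into [B_n (B_n h - B h)], which tends to 0 by the uniform bound, and
     [B_n (B h)], which tends to [B (B h)]. *)
  have BnBh := rel_cvg_op s0 (fun n => linear_opB (BnL n)) Bns (BnB h).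
  have := rel_cvgD BnBh (BnB (B h)).
  by rewrite add0r; congr rel_cvg; apply/funext => n; rewrite subrK.
exists B; split => // [h|C a a0 CL Ca CA h].
  have : B h + B h = A h + B (B h).
    by rewrite {1 2}BB -scalercD [_ + _](_ : _ = 1) ?scalerc1 //; field.
  rewrite (linear_opB BL) => hh.
  have -> : A h = B h + B h - B (B h) by rewrite hh addrK.
  by rewrite -[B h + B h - _]addrA [in RHS]opprD addrA.
apply: (rel_cvg_uniq (rel_cvg_op1 a0 (linear_opB CL) Ca (BnB h))).
have := BnB (C h); congr rel_cvg; apply/funext => n.
by rewrite BnC.
Qed.

(** With [S = (1 - B) N] and [N = (1 - A)^-1] commuting with [B],
    [S^2 (1 - A) = (1 - B)^2 N = 1]. *)
Lemma inv_sqrt_one_minus (A : H -> H) s : 0 < s < 1 ->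
  is_adjoint g A A -> op_le A s ->
  exists S, [/\ is_adjoint g S S,
    forall h, S (S (h - A h)) = h &
    forall C a, 0 < a -> linear_op C -> op_le C a ->
      (forall h, C (A h) = A (C h)) -> forall h, C (S h) = S (C h)].
Proof.
move=> s01 AA As; have /andP[s0 _] := s01.
have AL := is_adjoint_linear AA.
have [B [BA BB BC]] := sqrt_one_minus s01 AA As.
have BL := is_adjoint_linear BA.
have /choice[N NA] h := neumann h s01 AL As.
(* So far [N] is only a right inverse; the defect [N (x - A x) - x] is fixed by [A], hence 0. *)
have AN x : N (x - A x) = x.
  apply/eqP; rewrite -subr_eq0; apply/eqP/(op_le_fixpoint s01 As).
  have := NA (x - A x); set y := N _ => yx.
  rewrite (linear_opB AL); apply/eqP; rewrite eq_sym subr_eq; apply/eqP.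
  by rewrite -[LHS](subrK (A y)) yx addrC [RHS]addrAC addrA.
(* Moving [1 - A] across the gramian gives self-adjointness, and through it the linearity of the
   pointwise chosen [N]. *)
have NN : is_adjoint g N N.
  move=> x y; rewrite -{1}(NA y) gramBr -AA -gramBl.
  by rewrite NA.
have NC C : linear_op C -> (forall h, C (A h) = A (C h)) ->
    forall h, C (N h) = N (C h).
  by move=> CL CA h; rewrite -{2}(NA h) (linear_opB CL) CA AN.
have BAC h : B (A h) = A (B h) by rewrite -(BC A s).
have BN := NC _ BL BAC.
have NL := is_adjoint_linear NN.
exists (fun h => N h - B (N h)); split => [h k|h|C a a0 CL Ca CA h].
- by rewrite gramBl gramBr BA !NN BN.
- by rewrite AN BN -(linear_opB NL) BB AN.
- rewrite (linear_opB CL) NC // (BC C a) // NC //.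
Qed.

End Gramian.

(** * The partial isometry between the two projections *)

Theorem theorem2p1 (R : realType) (Z : tvsType R[i]) (star : Z -> Z)
    (Zpos : set Z) (HZ : admissible star Zpos)
    (H : lmodType R[i]) (g : H -> H -> Z) (HH : loynes_space star Zpos g)
    (P Q : H -> H) :
  gram_projection Zpos g P -> gram_projection Zpos g Q ->
  opnorm Zpos g (fun h => P h - Q h) < 1 ->
  exists T Tadj : H -> H,
    [/\ partial_isometry g T, is_adjoint g T Tadj,
        forall h, P h = Tadj (T h) &
        forall h, Q h = T (Tadj h)].
Proof.
move=> [[[PL [p [p0 Pp]]] _] PA PP] [[[QL [q [q0 Qq]]] _] QA QQ] PQ1.
pose D h := P h - Q h; pose A h := D (D h).
(* [p + q] bounds [D], so the norm is the infimum of a nonempty set and some actual bound [r] lies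
   below 1. *)
have [r [r0 Dr] r1] : exists2 r, op_bounds Zpos g D r & r < 1.
  apply: inf_lt PQ1; exists (p + q); split; first exact: addr_gt0.
  move=> h; apply: (dominatedD HZ HH p0 q0) (Pp h) _.
  exact: (dominatedN HZ HH (Qq h)).
have PB := linear_opB PL; have QB := linear_opB QL.
have DA : is_adjoint g D D.
  by move=> h k; rewrite /D (gramBl HH) (gramBr HZ HH) PA QA.
have AA : is_adjoint g A A by move=> h k; rewrite /A !DA.
have r01 : 0 < r * r < 1 by rewrite mulr_gt0 //= -expr2 expr_lt1 // ltW.
have Ar : op_le Zpos g A (r * r).
  by move=> h; apply: (dominated_op HZ Dr); exact: Dr.
have AE h : A h = P h - P (Q h) - (Q (P h) - Q h).
  by rewrite /A /D PB QB PP QQ.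
have PAE h : P (A h) = P h - P (Q (P h)) by rewrite AE !PB !PP opprB subrKA.
have APE h : A (P h) = P h - P (Q (P h)) by rewrite AE !PP subrr subr0.
have QAE h : Q (A h) = Q h - Q (P (Q h)).
  by rewrite AE !QB !QQ opprB addrC subrKA.
have AQE h : A (Q h) = Q h - Q (P (Q h)).
  by rewrite AE !QQ subrr sub0r opprB.
have PQP h : P (Q (P h)) = P (h - A h) by rewrite PB PAE subKr.
have QPQ h : Q (P (Q h)) = Q (h - A h) by rewrite QB QAE subKr.
have [S [SA SS SC]] := inv_sqrt_one_minus HZ HH r01 AA Ar.
have SL := is_adjoint_linear HH SA.
have SP h : P (S h) = S (P h).
  by apply: (SC P p) => // k; rewrite PAE APE.
have SQ h : Q (S h) = S (Q h).
  by apply: (SC Q q) => // k; rewrite QAE AQE.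
have ASC h : A (S h) = S (A h).
  apply: (SC A (r * r)) => //; first by case/andP: r01.
  exact: (is_adjoint_linear HH AA).
(* [S^2] is also a right inverse of [1 - A]; this order is the one used for [Q = T Ta]. *)
have SK h : S (S h) - A (S (S h)) = h.
  by rewrite !ASC -!(linear_opB SL) SS.
pose T h := Q (P (S h)); pose Ta h := S (P (Q h)).
have TT : is_adjoint g T Ta by move=> h k; rewrite /T /Ta QA PA SA.
have TaT h : P h = Ta (T h).
  by rewrite /Ta /T QQ PQP -SP ASC -!(linear_opB SL) SS.
have TTa h : Q h = T (Ta h).
  by rewrite /T /Ta -!SP PP -!SQ QPQ SK.
have TL := is_adjoint_linear HH TT.
(* [T] and [P] have the same kernel, whose gramian complement is the range of [P]; [perpP] and
   [perp_fix] are the two inclusions. *)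
have T0 h : T h = 0 <-> P h = 0.
  split=> [Th|Ph].
    by rewrite TaT Th /Ta (linear_op0 QL) (linear_op0 PL) (linear_op0 SL).
  by rewrite /T SP Ph (linear_op0 SL) (linear_op0 QL).
have perpP h : gperp g (kernel T) (P h).
  by move=> m /T0 Pm; rewrite PA Pm (gram0r HZ HH).
have perp_fix h : gperp g (kernel T) h -> P h = h.
  move=> hk; apply/eqP; rewrite eq_sym -subr_eq0; apply/eqP.
  apply: (gram_eq0 HH).
  rewrite (gramBl HH) hk; last by apply/T0; rewrite PB PP subrr.
  by rewrite PA PB PP subrr (gram0r HZ HH) subr0.
have QT h : Q (T h) = T h by rewrite /T QQ.
exists T, Ta; split => //; split => //.
- move=> h; exists (h - P h), (P h); split; last by rewrite subrK.
  + by apply/T0; rewrite PB PP subrr.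
  + exact: perpP.
(* [T = Q T] and [Q = T Ta] identify the range of [T] with that of [Q]. *)
- move=> h; exists (Q h), (h - Q h); split; last by rewrite subrKC.
  + by exists (Ta h) => //; rewrite -TTa.
  + move=> _ [k _ <-]; rewrite -(QT k) -QA QB QQ subrr.
    exact: (gram0l HH).
- by move=> h k _ kk; rewrite TT -TaT perp_fix.
- move=> _ [h _ <-]; exists (P h) => //.
  by rewrite /T -SP PP.
Qed.
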